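(* Let $T$ be a (closed, non-degenerate) triangle in the plane. The family of all homothets of $T$ is self-coverable with self-coverability function $f(k)=2k+1$, and this is sharp: for every integer $k\ge 0$ and every self-coverability function $g$ of this family, $g(k)\ge 2k+1$.
   Context: A homothet of a planar set $T$ is a set of the form $\lambda T+v$ with $\lambda>0$ and $v\in\mathbb R^2$. A collection of closed sets $\mathcal S$ is self-coverable if there exists a function $f$ from the non-negative integers to the non-negative integers (a self-coverability function of $\mathcal S$) such that for any $S\in\mathcal S$ and any finite point set $P\subset S$ with $|P|=k$ there exists a subcollection $\mathcal S'\subset\mathcal S$ with $|\mathcal S'|\le f(k)$ such that $\bigcup\mathcal S'=S$ and no point of $P$ is in the interior of any $S'\in\mathcal S'$. *)

(* Defs.v *)
From HB Require Import structures.
From mathcomp Require Import all_boot all_order all_algebra.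
From mathcomp Require Import all_classical all_reals all_analysis.
Set Implicit Arguments.
Unset Strict Implicit.
Unset Printing Implicit Defensive.
Import Order.TTheory GRing.Theory Num.Theory.
Import numFieldNormedType.Exports.
Local Open Scope classical_set_scope.
Local Open Scope ring_scope.
Local Open Scope card_scope.

(* The plane is the space of row vectors 'rV[R]_2, with its norm topology. *)
Definition closed_triangle (R : realType) (a b c : 'rV[R]_2) : set 'rV[R]_2 :=
  [set x | exists s t u : R, [/\ 0 <= s, 0 <= t, 0 <= u, s + t + u = 1 &
                                 x = s *: a + t *: b + u *: c]].

(* Linear independence of the two edge vectors: the vertices are not collinear. *)
Definition nondegenerate_triangle (R : realType) (T : set 'rV[R]_2) : Prop :=
  exists a b c : 'rV[R]_2, free [:: b - a; c - a] /\ T = closed_triangle a b c.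

Definition homothets (R : realType) (T : set 'rV[R]_2) : set (set 'rV[R]_2) :=
  [set S | exists (l : R) (v : 'rV[R]_2),
     0 < l /\ S = [set l *: x + v | x in T]].

Definition self_coverability_function (X : topologicalType)
    (F : set (set X)) (f : nat -> nat) : Prop :=
  forall (S : set X) (P : set X) (k : nat),
    F S -> P `<=` S -> P #= `I_k ->
    exists G : set (set X),
      [/\ G `<=` F,
          G #<= `I_(f k),
          \bigcup_(S' in G) S' = S
        & forall p S', P p -> G S' -> ~ (S'°) p].

(* Self-coverability is only defined for collections of closed sets, so
   closedness of the members is part of the notion. *)
Definition self_coverable (X : topologicalType) (F : set (set X)) : Prop :=
  (forall S, F S -> closed S) /\
  exists f : nat -> nat, self_coverability_function F f.

(* Main.v *)
(** In barycentric coordinates the homothets of the triangle are the sets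
    [{x >= g1, y >= g2, z >= g3}] with [g1 + g2 + g3 < 1], so a homothet is a
    corner [g], and a point is interior to it iff it strictly dominates [g].

    Upper bound: sweep the points by decreasing third coordinate, maintaining
    corners that avoid all the points swept and cover the triangle; each point
    increases their number by at most two.  The corners with
    [g1 + g2 + g3 >= 1] cover finitely many points, hence can be dropped as the
    rest is closed.

    Lower bound: take [k] points on a median, at distances from a vertex
    decreasing geometrically, and [2k + 1] witnesses, namely that vertex and [k]
    points on each of the two sides issued from it.  The scales are chosen so
    that every homothet containing two witnesses has one of the [k] points in
    its interior. *)

Require Import Defs.
From HB Require Import structures.
From mathcomp Require Import all_boot all_order all_algebra.
From mathcomp Require Import all_classical all_reals all_analysis.
From mathcomp Require Import ring lra zify.
Import Order.TTheory GRing.Theory Num.Theory.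
Import numFieldNormedType.Exports.
Local Open Scope classical_set_scope.
Local Open Scope ring_scope.
Local Open Scope card_scope.

(** * Dominance of coordinate triples and the sweep *)

Definition dom {R : realDomainType} (g q : R * R * R) : bool :=
  [&& g.1.1 <= q.1.1, g.1.2 <= q.1.2 & g.2 <= q.2].

Definition sdom {R : realDomainType} (g q : R * R * R) : bool :=
  [&& g.1.1 < q.1.1, g.1.2 < q.1.2 & g.2 < q.2].

Definition total {R : realDomainType} (q : R * R * R) : R :=
  q.1.1 + q.1.2 + q.2.

Lemma seq_argmin {R : realDomainType} {I : eqType} (f : I -> R) (s : seq I) :
  s != [::] -> exists2 m, m \in s & {in s, forall v, f m <= f v}.
Proof.
elim: s => // i [|j s] IH _.
  by exists i; rewrite ?mem_head // => v; rewrite inE => /eqP->.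
have [//|m ms min_m] := IH.
have [le_im|le_mi] := leP (f i) (f m).
  exists i; first exact: mem_head.
  by move=> v; rewrite inE => /predU1P[->//|/min_m]; apply: le_trans.
exists m; first by rewrite inE ms orbT.
by move=> v; rewrite inE => /predU1P[->|/min_m//]; apply: ltW.
Qed.

(* [A] holds the corners whose last coordinate is still that of [g0], [B] the
   other ones.  A new point [p] has the least last coordinate so far, so it can
   only be interior to triangles of [A]; those it is interior to are cut off at
   the height of [p] and moved to [B], and the strip below is covered by two
   new triangles, one on either side of [p]. *)
Lemma corner_sweep {R : realDomainType} (g0 : R * R * R) (s : seq (R * R * R)) :
  sorted (fun p q : R * R * R => p.2 <= q.2) s ->
  (forall p, p \in s -> total p = 1 /\ dom g0 p) ->
  exists (A : seq (R * R)) (B : seq (R * R * R)),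
    let G := [seq (ab, g0.2) | ab <- A] ++ B in
    [/\ (size G <= 2 * size s + 1)%N,
        {in G, forall g, dom g0 g},
        {in G & s, forall g p, ~~ sdom g p},
        {in B, forall g, exists2 p, p \in s & p.2 <= g.2}
      & forall q, total q = 1 -> dom g0 q -> exists2 g, g \in G & dom g q].
Proof.
elim: s => [|p s IH] /=.
  move=> _ _; exists [:: g0.1], [::]; split=> //=.
  - by move=> g; rewrite inE => /eqP->; rewrite /dom !lexx.
  - by move=> q _ q0; exists g0; rewrite // inE -surjective_pairing.
move=> ps_sorted ps_in.
have p_min q : q \in s -> p.2 <= q.2.
  move/order_path_min: ps_sorted => /(_ _)/allP; apply.
  by move=> ? ? ?; apply: le_trans.
have {IH}[||A [B [sizeG G_in G_free B_above G_cover]]] := IH.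
- exact: path_sorted ps_sorted.
- by move=> q qs; apply: ps_in; rewrite inE qs orbT.
have [p1 p0] := ps_in p (mem_head _ _).
pose viol (ab : R * R) := (ab.1 < p.1.1) && (ab.2 < p.1.2).
have inA ab : ab \in A -> (ab, g0.2) \in [seq (ab, g0.2) | ab <- A] ++ B.
  by move=> abA; rewrite mem_cat map_f.
have inB g : g \in B -> g \in [seq (ab, g0.2) | ab <- A] ++ B.
  by move=> gB; rewrite mem_cat gB orbT.
have B_free g : g \in B -> ~~ sdom g p.
  move=> /B_above[q qs qg]; rewrite /sdom [g.2 < _]ltNge.
  by rewrite (le_trans (p_min _ qs) qg) !andbF.
have [V0|V0] := eqVneq [seq ab <- A | viol ab] [::].
  have A_free ab : ab \in A -> ~~ viol ab.
    move=> abA; apply/negP=> v; have : ab \in [::] by rewrite -V0 mem_filter v.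
    by rewrite in_nil.
  exists A, B; split=> //.
  - by apply: leq_trans sizeG _; rewrite leq_add2r leq_mul2l leqnSn.
  - move=> g q gG; rewrite inE => /predU1P[->|]; last exact: G_free.
    move: gG; rewrite mem_cat => /orP[/mapP[ab abA ->]|/B_free//].
    by have := A_free _ abA; rewrite /sdom /viol /= andbA => /negPf->.
  - by move=> g /B_above[q qs qg]; exists q; rewrite // inE qs orbT.
(* Each new corner is [v2] or [v1] with one coordinate raised to that of [p]: it cuts out a part of
   an old triangle and [p] is not interior to it. Minimality of [v1] and [v2] lets these two corners
   serve all the corners satisfying [viol] at once. *)
have [v1 v1V min1] := seq_argmin (fun ab => ab.1) _ V0.
have [v2 v2V min2] := seq_argmin (fun ab => ab.2) _ V0.
move: (v1V) (v2V); rewrite !mem_filter => /andP[viol1 v1A] /andP[viol2 v2A].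
exists [:: (p.1.1, v2.2), (v1.1, p.1.2) & [seq ab <- A | ~~ viol ab]].
exists ([seq (ab, p.2) | ab <- A & viol ab] ++ B).
move: (G_in _ (inA _ v1A)) (G_in _ (inA _ v2A)); rewrite /dom /=.
move=> /and3P[v11 v12 _] /and3P[v21 v22 _].
move: (p0) (viol1) (viol2); rewrite /dom /viol.
move=> /and3P[px py pz] /andP[v11p v12p] /andP[v21p v22p].
split=> /=.
- move: sizeG; rewrite !size_cat !size_map !size_filter -(count_predC viol A).
  move: (count viol A) (count (predC viol) A) (size B) => n1 n2 n3.
  by clear; lia.
- move=> g; rewrite !inE mem_cat => /predU1P[->|/predU1P[->|]].
  + by rewrite /dom /= px v22 lexx.
  + by rewrite /dom /= py v11 lexx.
  case/orP=> [/mapP[ab]|].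
    by rewrite mem_filter => /andP[_ abA] ->; exact: G_in (inA _ abA).
  rewrite mem_cat => /orP[/mapP[ab]|gB]; last exact: G_in (inB _ gB).
  rewrite mem_filter => /andP[_ abA] ->.
  by have := G_in _ (inA _ abA); rewrite /dom /= pz => /and3P[-> ->].
- have mono g g' q : dom g' g -> ~~ sdom g' q -> ~~ sdom g q.
    move=> /and3P[l1 l2 l3]; apply: contra => /and3P[h1 h2 h3].
    by rewrite /sdom (le_lt_trans l1) ?(le_lt_trans l2) ?(le_lt_trans l3).
  move=> g q; rewrite !inE mem_cat => /predU1P[->|/predU1P[->|gG]].
  + case/predU1P=> [->|qs]; first by rewrite /sdom /= ltxx.
    apply: mono (G_free _ _ (inA _ v2A) qs).
    by rewrite /dom /= !lexx ltW.
  + case/predU1P=> [->|qs]; first by rewrite /sdom /= ltxx andbF.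
    apply: mono (G_free _ _ (inA _ v1A) qs).
    by rewrite /dom /= !lexx ltW.
  case/orP: gG => [/mapP[ab]|].
    rewrite mem_filter => /andP[Nv abA] ->.
    case/predU1P=> [->|qs]; last exact: G_free (inA _ abA) qs.
    by move: Nv; rewrite /sdom /viol /= andbA => /negPf->.
  rewrite mem_cat => /orP[/mapP[ab]|gB]; last first.
    by case/predU1P=> [->|qs]; [exact: B_free | exact: G_free (inB _ gB) qs].
  rewrite mem_filter => /andP[v abA] ->.
  case/predU1P=> [->|qs]; first by rewrite /sdom /= ltxx !andbF.
  apply: mono (G_free _ _ (inA _ abA) qs).
  by rewrite /dom /= !lexx.
- move=> g; rewrite mem_cat => /orP[/mapP[ab _ ->]|/B_above[q qs qg]].
    by exists p; rewrite ?mem_head /=.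
  by exists q; rewrite // inE qs orbT.
move=> q q1 q0; have [g gG gq] := G_cover q q1 q0.
have keep g' : (g' \in [seq (ab, g0.2) | ab <- A & ~~ viol ab]) ||
    (g' \in [seq (ab, p.2) | ab <- A & viol ab] ++ B) ->
    g' \in [:: (p.1.1, v2.2, g0.2), (v1.1, p.1.2, g0.2)
       & [seq (ab, g0.2) | ab <- A & ~~ viol ab] ++
         [seq (ab, p.2) | ab <- A & viol ab] ++ B].
  by move=> h; rewrite !in_cons mem_cat h !orbT.
move: gG; rewrite mem_cat => /orP[/mapP[ab abA gE]|gB]; last first.
  by exists g; rewrite // keep // mem_cat gB !orbT.
have [v|Nv] := boolP (viol ab); last first.
  by exists g; rewrite // keep // gE map_f // mem_filter Nv.
have abV : ab \in [seq ab <- A | viol ab] by rewrite mem_filter v.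
have /= := (min1 _ abV, min2 _ abV); move=> [le1 le2].
move: gq q0; rewrite gE /dom /= => /and3P[q_1 q_2 _] /and3P[_ _ q_3].
have [pq|qp] := leP p.2 q.2.
  exists (ab, p.2); last by rewrite /= q_1 q_2.
  by rewrite keep // mem_cat map_f ?orbT.
have [pq|qp1] := leP p.1.1 q.1.1.
  exists (p.1.1, v2.2, g0.2); first exact: mem_head.
  by rewrite /= pq q_3 (le_trans le2).
(* Here the first and third coordinates of [q] are below those of [p]; both totals being 1, the
   second one is above. *)
exists (v1.1, p.1.2, g0.2); first by rewrite !inE eqxx orbT.
rewrite /= q_3 (le_trans le1) //= andbT.
by move: q1 p1; rewrite /total; lra.
Qed.

(** * Discarding degenerate corners *)

Lemma small_perturbation {R : realFieldType} (u v w : R) :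
  u < v -> exists2 e, 0 < e & forall t, 0 < t < e -> u + t * w < v.
Proof.
move=> uv; have w1 : 0 < `|w| + 1 by rewrite ltr_wpDl.
exists ((v - u) / (`|w| + 1)); first by rewrite divr_gt0 ?subr_gt0.
move=> t /andP[t0]; rewrite ltr_pdivlMr // => tw.
have := ler_wpM2l (ltW t0) (ler_norm w); lra.
Qed.

Definition line3 {R : realDomainType} (q m : R * R * R) (t : R) : R * R * R :=
  (q.1.1 + t * (m.1.1 - q.1.1), q.1.2 + t * (m.1.2 - q.1.2),
   q.2 + t * (m.2 - q.2)).

(* A corner with [total g >= 1] is dominated by at most one point of total 1, so
   it can be disregarded near [q] on a segment issued from [q]. *)
Lemma dom_near {R : realFieldType} (q m : R * R * R) (G : seq (R * R * R)) :
  total q = 1 -> total m = 1 -> m.1.1 != q.1.1 ->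
  exists2 e, 0 < e & forall t, 0 < t < e ->
    {in G, forall g, dom g (line3 q m t) -> dom g q && (total g < 1)}.
Proof.
move=> q1 m1 mq; elim: G => [|g G [e e0 He]]; first by exists 1.
suff [d d0 Hd] : exists2 d, 0 < d & forall t, 0 < t < d ->
    dom g (line3 q m t) -> dom g q && (total g < 1).
  exists (Num.min d e); first by rewrite lt_min d0.
  move=> t /andP[t0]; rewrite lt_min => /andP[td te] g'.
  rewrite inE => /predU1P[->|]; first by apply: Hd; rewrite t0.
  by apply: He; rewrite t0.
case: (boolP (dom g q)) => /= [gq|].
  have [g1|g1] := ltP (total g) 1; first by exists 1.
  (* A triple of total 1 dominating [g] must equal [g] when [total g >= 1]. So [q] and the point of
     the segment would coincide, although [m] and [q] differ in the first coordinate. *)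
  exists 1 => // t /andP[t0 _] /and3P[/= h1 h2 h3].
  move: gq g1 q1 m1 => /and3P[]; rewrite /total => l1 l2 l3 g1 q1 m1.
  have : t * (m.1.1 - q.1.1) == 0 by apply/eqP; nra.
  by rewrite mulf_eq0 gt_eqF //= subr_eq0 (negPf mq).
(* Some coordinate of [q] is strictly below that of [g], and stays so for small [t]. *)
rewrite /dom !negb_and -!ltNge => /or3P[] gq;
  [have [e' e'0 He'] := small_perturbation _ _ (m.1.1 - q.1.1) gq
  |have [e' e'0 He'] := small_perturbation _ _ (m.1.2 - q.1.2) gq
  |have [e' e'0 He'] := small_perturbation _ _ (m.2 - q.2) gq];
  exists e' => // t /He'; rewrite ltNge /= => /negPf->; by rewrite ?andbF.
Qed.

(** The sweep may produce corners of total at least 1. To drop them, move from [q] slightly towards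
    another point of the triangle: the corner covering the moved point is nondegenerate and covers
    [q] as well. *)
Lemma corner_cover {R : realFieldType} (g0 : R * R * R) (s : seq (R * R * R)) :
  total g0 < 1 -> (forall p, p \in s -> total p = 1 /\ dom g0 p) ->
  exists G : seq (R * R * R),
    [/\ (size G <= 2 * size s + 1)%N,
        {in G, forall g, dom g0 g /\ total g < 1},
        {in G & s, forall g p, ~~ sdom g p}
      & forall q, total q = 1 -> dom g0 q -> exists2 g, g \in G & dom g q].
Proof.
move=> g01 s_in; pose r := fun p q : R * R * R => p.2 <= q.2.
have [||A [B]] := corner_sweep g0 (sort r s).
- by apply: sort_sorted => p q; apply: le_total.
- by move=> p; rewrite mem_sort; apply: s_in.
move: (_ ++ B) => G /=; rewrite size_sort => -[sizeG G_in G_free _ G_cover].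
exists [seq g <- G | total g < 1]; split.
- by rewrite size_filter (leq_trans (count_size _ _)).
- by move=> g; rewrite mem_filter => /andP[-> /G_in].
- move=> g p; rewrite mem_filter => /andP[_ gG] ps.
  by apply: G_free => //; rewrite mem_sort.
move=> q q1 q0.
(* [m] is a vertex of the triangle: the one with the largest first coordinate if that of [q] is
   minimal, otherwise one where it is minimal. *)
have [m [m1 m0 mq]] : exists m, [/\ total m = 1, dom g0 m & m.1.1 != q.1.1].
  case: (eqVneq g0.1.1 q.1.1) => [gq|gq].
    exists (1 - g0.1.2 - g0.2, g0.1.2, g0.2).
    rewrite /total /dom /= !lexx andbT -gq /=.
    by move: g01; rewrite /total => g01; split; [ring|lra|rewrite gt_eqF //; lra].
  exists (g0.1.1, 1 - g0.1.1 - g0.2, g0.2).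
  rewrite /total /dom /= !lexx andbT /= gq.
  by move: g01; rewrite /total => g01; split; [ring|lra|].
have [e e0 He] := dom_near q m G q1 m1 mq.
have [t [t0 t1 te]] : exists t, [/\ 0 < t, t < 1 & t < e].
  exists (Num.min (1 / 2) (e / 2)); rewrite lt_min !gt_min.
  by split; [apply/andP; split; lra| |]; apply/orP; [left|right]; lra.
have [||g gG gt] := G_cover (line3 q m t).
- by move: q1 m1; rewrite /total /line3 /= => q1 m1; nra.
- move: q0 m0 => /and3P[q01 q02 q03] /and3P[m01 m02 m03].
  by apply/and3P; split=> /=; nra.
have := He t; rewrite t0 te => /(_ isT _ gG gt)/andP[gq g1].
by exists g; rewrite // mem_filter g1.
Qed.

(** * Barycentric coordinates in the plane *)

Definition affine_comb {R : realType} (a b c : 'rV[R]_2) (s : R * R * R) :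
  'rV[R]_2 := s.1.1 *: a + s.1.2 *: b + s.2 *: c.

Record barycentric {R : realType} (a b c : 'rV[R]_2)
    (co : 'rV[R]_2 -> R * R * R) : Prop := Barycentric {
  bary_total : forall q, total (co q) = 1;
  bary_comb : forall q, affine_comb a b c (co q) = q;
  comb_bary : forall s, total s = 1 -> co (affine_comb a b c s) = s;
  bary_continuous1 : continuous (fun q => (co q).1.1);
  bary_continuous2 : continuous (fun q => (co q).1.2);
  bary_continuous3 : continuous (fun q => (co q).2) }.

Lemma ord2P (i : 'I_2) : i = 0 \/ i = 1.
Proof.
by case: i => [[|[|n]] lt2] //; [left|right]; apply: val_inj.
Qed.

Lemma free2_det {F : fieldType} (u v : 'rV[F]_2) :
  free [:: u; v] -> u 0 0 * v 0 1 - u 0 1 * v 0 0 != 0.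
Proof.
rewrite free_cons seq1_free span_seq1 => /andP[/negP u_v v0].
apply/negP; rewrite subr_eq0 => /eqP D0; apply: u_v.
have row2 (w w' : 'rV[F]_2) : w 0 0 = w' 0 0 -> w 0 1 = w' 0 1 -> w = w'.
  move=> e0 e1; apply/rowP=> i.
  by have [->|->] := ord2P i.
apply/vlineP; have [v00|v00] := eqVneq (v 0 0) 0.
  have v01 : v 0 1 != 0.
    by apply: contra_neq v0 => v01; apply: row2; rewrite mxE.
  exists (u 0 1 / v 0 1); apply: row2; rewrite mxE; last by rewrite divfK.
  by apply: (mulIf v01); rewrite D0 v00 !mulr0 mul0r.
exists (u 0 0 / v 0 0); apply: row2; rewrite mxE; first by rewrite divfK.
by rewrite mulrAC D0 mulfK.
Qed.

Lemma affine_continuous {R : realType} (k0 k1 k2 : R) :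
  continuous (fun q : 'rV[R]_2 => k0 * q 0 0 + k1 * q 0 1 + k2).
Proof.
move=> q.
have c i : (fun q : 'rV[R]_2 => q 0 i) @ q --> q 0 i by exact: coord_continuous.
exact: (cvgD (cvgD (cvgM (cvg_cst k0) (c 0)) (cvgM (cvg_cst k1) (c 1)))
  (cvg_cst k2)).
Qed.

Lemma barycentric_exists {R : realType} (a b c : 'rV[R]_2) :
  free [:: b - a; c - a] -> exists co, barycentric a b c co.
Proof.
move=> /free2_det; rewrite !mxE.
set D := (X in X != 0) => D0.
(* Cramer's rule for [q - a = y *: (b - a) + z *: (c - a)], expanded into the shape of
   [affine_continuous]. *)
pose y (q : 'rV[R]_2) := (c 0 1 - a 0 1) / D * q 0 0
  + - (c 0 0 - a 0 0) / D * q 0 1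
  + ((c 0 0 - a 0 0) * a 0 1 - (c 0 1 - a 0 1) * a 0 0) / D.
pose z (q : 'rV[R]_2) := - (b 0 1 - a 0 1) / D * q 0 0
  + (b 0 0 - a 0 0) / D * q 0 1
  + ((b 0 1 - a 0 1) * a 0 0 - (b 0 0 - a 0 0) * a 0 1) / D.
have cy : continuous y by exact: affine_continuous.
have cz : continuous z by exact: affine_continuous.
exists (fun q => (1 - y q - z q, y q, z q)); split=> //=.
- by move=> q; rewrite /total /=; ring.
- move=> q; apply/rowP=> i; rewrite /affine_comb !mxE /y /z /=.
  have [->|->] := ord2P i.
  + by rewrite /D in D0 *; field.
  + by rewrite /D in D0 *; field.
- move=> [[s1 s2] s3]; rewrite /total /= => s_1.
  have s1E : s1 = 1 - s2 - s3 by rewrite -s_1; ring.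
  have yE : y (affine_comb a b c (s1, s2, s3)) = s2.
    by rewrite /y /affine_comb !mxE /= s1E /D in D0 *; field.
  have zE : z (affine_comb a b c (s1, s2, s3)) = s3.
    by rewrite /z /affine_comb !mxE /= s1E /D in D0 *; field.
  by rewrite yE zE -s1E.
- have c1 : continuous (fun q : 'rV[R]_2 => 1 - y q - z q).
  by move=> q; exact: (cvgB (cvgB (cvg_cst (1 : R)) (cy q)) (cz q)).
exact: c1.
Qed.

(** * Homothets as corners, and their interiors *)

Definition corner {R : realType} (co : 'rV[R]_2 -> R * R * R) (g : R * R * R) :
  set 'rV[R]_2 := [set q | dom g (co q)].

Lemma closed_corner {R : realType} {a b c : 'rV[R]_2} {co} (g : R * R * R) :
  barycentric a b c co -> closed (corner co g).
Proof.
move=> bc.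
have -> : corner co g =
    (fun q => (co q).1.1) @^-1` [set x | g.1.1 <= x]
    `&` ((fun q => (co q).1.2) @^-1` [set x | g.1.2 <= x]
    `&` (fun q => (co q).2) @^-1` [set x | g.2 <= x]).
  by apply/seteqP; split=> q /= => [/and3P[]|[? []]] *; [|apply/and3P].
do 2?apply: closedI; (apply: preimage_closed; last exact: closed_ge) => q _.
- exact: bary_continuous1 bc _.
- exact: bary_continuous2 bc _.
- exact: bary_continuous3 bc _.
Qed.

Lemma nbhs_ray {R : realType} (p w : 'rV[R]_2) (U : set 'rV[R]_2) :
  nbhs p U -> exists2 t : R, 0 < t & U (p + t *: w).
Proof.
move=> pU; have ct : (fun t : R => p + t *: w) @ (0 : R) --> p.
  rewrite -[X in _ --> X]addr0 -(scale0r w).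
  apply: cvgD; first exact: cvg_cst.
  by apply: cvgZr_tmp; exact: cvg_id.
have /nbhs_ballP[e /= e0 He] := ct _ pU.
exists (e / 2); first by rewrite divr_gt0.
by apply: He; rewrite -ball_normE /= sub0r normrN gtr0_norm ?divr_gt0 //; lra.
Qed.

Lemma interior_corner {R : realType} {a b c : 'rV[R]_2} {co} (g : R * R * R)
    (p : 'rV[R]_2) :
  barycentric a b c co -> (corner co g)° p <-> sdom g (co p).
Proof.
move=> bc; split=> [pg|/and3P[p1 p2 p3]]; last first.
  apply: filterS3 (cvgr_gt _ (bary_continuous1 _ _ _ _ bc p) _ p1)
    (cvgr_gt _ (bary_continuous2 _ _ _ _ bc p) _ p2)
    (cvgr_gt _ (bary_continuous3 _ _ _ _ bc p) _ p3) => q q1 q2 q3.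
  by rewrite /corner /= /dom !ltW.
have ray d : total d = 0 -> exists2 t : R, 0 < t &
    dom g ((co p).1.1 + t * d.1.1, (co p).1.2 + t * d.1.2, (co p).2 + t * d.2).
  move=> d0; have [t t0 pt] := nbhs_ray p (affine_comb a b c d) _ pg.
  exists t => //; move: pt; rewrite /corner /=.
  rewrite -[p in p + _](bary_comb _ _ _ _ bc).
  set s := (X in dom g X -> _); set s' := (X in _ -> dom g X).
  suff -> : s = s' by [].
  rewrite /s -[RHS](comb_bary _ _ _ _ bc); last first.
    by move: d0 (bary_total _ _ _ _ bc p); rewrite /total /s' /=; nra.
  congr co; rewrite /affine_comb /s' /= !scalerDl !scalerDr !scalerA.
  by rewrite addrACA; congr (_ + _); rewrite addrACA.
(* Displacements have total 0. The first one lowers the first two coordinates and the second one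
   lowers the third; staying in the corner after both forces all three inequalities at [p] to be
   strict. *)
have [t t0 /and3P[/= t1 t2 _]] : _ := ray (-1, -1, 2) ltac:(rewrite /total /=; ring).
have [u u0 /and3P[/= _ _ u3]] : _ := ray (1, 1, -2) ltac:(rewrite /total /=; ring).
by apply/and3P; split; lra.
Qed.

(** The map [co] is affine rather than linear, whence the correction by [l * co 0]; the triangle is
    where all three coordinates are nonnegative. *)
Lemma homothet_corner {R : realType} {a b c : 'rV[R]_2} {co} (l : R)
    (v : 'rV[R]_2) :
  barycentric a b c co -> 0 < l ->
  [set l *: x + v | x in closed_triangle a b c] =
  corner co ((co v).1.1 - l * (co 0).1.1, (co v).1.2 - l * (co 0).1.2,
             (co v).2 - l * (co 0).2).
Proof.
move=> bc l0.
have coE x : co (l *: x + v) =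
    (l * (co x).1.1 + ((co v).1.1 - l * (co 0).1.1),
     l * (co x).1.2 + ((co v).1.2 - l * (co 0).1.2),
     l * (co x).2 + ((co v).2 - l * (co 0).2)).
  rewrite -[RHS](comb_bary _ _ _ _ bc); last first.
    move: (bary_total _ _ _ _ bc x) (bary_total _ _ _ _ bc v).
    by move: (bary_total _ _ _ _ bc 0); rewrite /total /=; nra.
  congr co; rewrite -{1}[x](bary_comb _ _ _ _ bc) -{1}[v](bary_comb _ _ _ _ bc).
  rewrite -[LHS]subr0 -[X in _ - X](scaler0 _ l) -{1}[0](bary_comb _ _ _ _ bc).
  by apply/rowP=> i; rewrite /affine_comb !mxE /=; ring.
apply/seteqP; split=> q /=.
  move=> [x [s [t [u [s0 t0 u0 stu xE]]]] <-]; rewrite /corner /= coE.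
  have -> : co x = (s, t, u) by rewrite xE; exact: (comb_bary _ _ _ _ bc (s, t, u)).
  by apply/and3P; split=> /=; rewrite lerDr mulr_ge0 // ltW.
have -> : q = l *: (l^-1 *: (q - v)) + v.
  by rewrite scalerA divff ?gt_eqF // scale1r subrK.
move: (l^-1 *: _) => {q} x; rewrite /corner /= coE => /and3P[/=].
rewrite !lerDr !pmulr_rge0 // => x1 x2 x3; exists x => //.
exists (co x).1.1, (co x).1.2, (co x).2; split=> //.
  exact: bary_total bc x.
by rewrite -{1}[x](bary_comb _ _ _ _ bc).
Qed.

Lemma homothets_corner {R : realType} {a b c : 'rV[R]_2} {co} :
  barycentric a b c co ->
  homothets (closed_triangle a b c) =
  [set S | exists2 g, total g < 1 & S = corner co g].
Proof.
move=> bc; apply/seteqP; split=> S /=.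
  move=> [l [v [l0 ->]]]; rewrite (homothet_corner _ _ bc l0).
  eexists; last reflexivity.
  move: (bary_total _ _ _ _ bc v) (bary_total _ _ _ _ bc 0).
  by rewrite /total /=; nra.
(* The corner of a homothet of ratio [l] has total [1 - l], which dictates [l]; then [m] is the
   coordinate triple of the translation vector. *)
move=> [g g1 ->]; pose l := 1 - total g.
pose m := (g.1.1 + l * (co 0).1.1, g.1.2 + l * (co 0).1.2, g.2 + l * (co 0).2).
have m1 : total m = 1.
  move: (bary_total _ _ _ _ bc 0); rewrite /m /l /total /=; nra.
exists l, (affine_comb a b c m).
have l0 : 0 < l by rewrite subr_gt0.
split=> //; rewrite (homothet_corner _ _ bc l0) (comb_bary _ _ _ _ bc _ m1).
by rewrite /m /= !addrK -!surjective_pairing.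
Qed.

(** * Finite cardinalities and the upper bound *)

Lemma card_le_seq {T : eqType} {U : Type} (f : T -> U) (s : seq T) (n : nat) :
  (size s <= n)%N -> [set f x | x in [set` s]] #<= `I_n.
Proof.
case: s => [|x0 s] sn; first by rewrite set_nil image_set0 card_ge0.
apply: card_le_trans (card_image_le _ _) _.
apply: card_le_trans (_ : _ #<= `I_(size (x0 :: s))) _; last by rewrite card_le_II.
apply: card_le_trans _ (card_image_le (nth x0 (x0 :: s)) _).
apply: subset_card_le => x /= xs; exists (index x (x0 :: s)).
  by have := xs; rewrite -index_mem.
by rewrite nth_index.
Qed.

Lemma card_II_seq {T : pointedType} (P : set T) (k : nat) :
  P #= `I_k -> exists2 s : seq T, size s = k & [set` s] = P.
Proof.
rewrite card_eq_sym => /pcard_eqP[e].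
exists [seq e i | i <- iota 0 k]; first by rewrite size_map size_iota.
apply/seteqP; split=> [x /= /mapP[i]|x Px].
  by rewrite mem_iota add0n => /andP[_ ik] ->; exact: funS.
have [i ik <-] := @surj _ _ _ _ e _ Px.
by rewrite /= map_f // mem_iota.
Qed.

Lemma triangle_self_coverable {R : realType} {a b c : 'rV[R]_2} {co} :
  barycentric a b c co ->
  self_coverability_function (homothets (closed_triangle a b c))
    (fun k => (2 * k + 1)%N).
Proof.
move=> bc S P k; rewrite (homothets_corner bc) => -[g0 g01 ->] PS.
move=> /card_II_seq[s sk sP].
have [|G [sizeG G_in G_free G_cover]] := corner_cover g0 (map co s) g01.
  move=> _ /mapP[p ps ->]; split; first exact: bary_total bc p.
  by apply: PS; rewrite -sP.
exists [set corner co g | g in [set` G]]; split.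
- by move=> _ [g /= gG <-]; exists g => //; case: (G_in _ gG).
- by apply: card_le_seq; rewrite -sk -(size_map co).
- apply/seteqP; split=> [q [_ [g /= gG <-]]|q q0].
    case: (G_in _ gG) => /and3P[g1 g2 g3] _ /and3P[q1 q2 q3].
    by rewrite /corner /= /dom (le_trans g1) ?(le_trans g2) ?(le_trans g3).
  have [g gG gq] := G_cover _ (bary_total _ _ _ _ bc q) q0.
  by exists (corner co g) => //; exists g.
move=> p _ Pp [g /= gG <-] /(interior_corner _ _ bc).
by apply/negP/G_free => //; apply: map_f; rewrite -sP in Pp.
Qed.

(** * Witnesses, obstacles and the lower bound *)

(* The two sides issued from the vertex [(0, 0, 1)] carry the witnesses of odd
   and of even index, and [witness k (2 * k)] is that vertex. *)
Definition witness {R : realFieldType} (k j : nat) : R * R * R :=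
  let e := 4^-1 ^+ j./2 in
  if j == (2 * k)%N then (0, 0, 1)
  else if odd j then (e, 0, 1 - e) else (0, e, 1 - e).

(* [t] is chosen with [4^-m.+1 < t < 4^-m / 2]: the first bound puts the
   obstacle beyond the later witnesses on the same side, the second one puts it
   above the two witnesses of scale [4^-m] in the third coordinate. *)
Definition obstacle {R : realFieldType} (m : nat) : R * R * R :=
  let t := 4^-1 ^+ m / 3 in (t, t, 1 - 2 * t).

Lemma quarter_pow {R : realFieldType} (n : nat) :
  0 < (4^-1 : R) ^+ n <= 1.
Proof. by rewrite exprn_gt0 //= exprn_ile1 //; lra. Qed.

Lemma total_witness {R : realFieldType} (k j : nat) :
  total (witness k j : R * R * R) = 1 /\ dom (0, 0, 0) (witness k j : R * R * R).
Proof.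
have /andP[e0 e1] := @quarter_pow R j./2.
rewrite /witness /total /dom; case: ifP => _ /=; last case: ifP => _ /=;
  by split; [ring|apply/and3P; split; lra].
Qed.

Lemma total_obstacle {R : realFieldType} (m : nat) :
  total (obstacle m : R * R * R) = 1 /\ dom (0, 0, 0) (obstacle m : R * R * R).
Proof.
have /andP[e0 e1] := @quarter_pow R m.
by rewrite /obstacle /total /dom /=; split; [field|apply/and3P; split; lra].
Qed.

(** Ensures that the first [k] obstacles form a set of exactly [k] points. *)
Lemma obstacle_inj {R : realFieldType} : injective (@obstacle R).
Proof.
move=> m n [/(mulIf _) mn _ _]; have {}mn := mn ltac:(rewrite invr_eq0; lra).
apply/eqP; rewrite eqn_leq -!(@ler_iXn2l R 4^-1) ?mn ?lexx //; lra.
Qed.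

(** Since [i < 2 * k], witness [i] is not the vertex and bounds the third coordinate of [g] by
    [1 - e]. If [j] is on the other side or is the vertex, the first two coordinates of [g] are at
    most 0; on the same side, one is at most 0 and the other at most [f <= e / 4 < e / 3]. *)
Lemma witness_separated {R : realFieldType} (k i j : nat) (g : R * R * R) :
  (i < j)%N -> (j < 2 * k + 1)%N -> dom g (witness k i) -> dom g (witness k j) ->
  sdom g (obstacle i./2).
Proof.
move=> ij jk; rewrite /witness ltn_eqF; last by lia.
set e := 4^-1 ^+ i./2; set f := 4^-1 ^+ j./2.
have /andP[e0 _] : 0 < e <= 1 := quarter_pow _.
have /andP[f0 _] : 0 < f <= 1 := quarter_pow _.
have fe : odd i == odd j -> f <= e / 4.
  move=> oij; rewrite /f /e -exprSr; apply: ler_wiXn2l; [lra|lra|].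
  by move: oij; lia.
rewrite /obstacle -/e /dom /sdom /=.
case: (odd i) fe; case: (odd j); case: (j == _) => /= fe.
all: move=> /and3P[? ? ?] /and3P[? ? ?]; apply/and3P; split => /=.
all: by [lra | have := fe isT; lra].
Qed.

(** Choosing for each witness a member of the cover that contains it gives a map that is injective
    on the [2 * k + 1] indices, as a member shared by two witnesses would have an obstacle in its
    interior. *)
Lemma triangle_self_coverability_lower {R : realType} {a b c : 'rV[R]_2} {co}
    (f : nat -> nat) (k : nat) :
  barycentric a b c co ->
  self_coverability_function (homothets (closed_triangle a b c)) f ->
  (2 * k + 1 <= f k)%N.
Proof.
move=> bc fP; pose pt := affine_comb a b c.
have co_pt s : total s = 1 /\ dom (0, 0, 0) s -> co (pt s) = s.
  by case=> s1 _; exact: comb_bary bc s s1.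
pose S := corner co (0, 0, 0).
have S_pt s : total s = 1 /\ dom (0, 0, 0) s -> S (pt s).
  by move=> sP; rewrite /S /corner /= co_pt //; case: sP.
pose P := [set pt (obstacle m) | m in `I_k].
have [|||G [GT Gf GS Gfree]] := fP S P k.
- rewrite (homothets_corner bc); exists (0, 0, 0) => //.
  by rewrite /total /= !addr0.
- by move=> _ [m _ <-]; apply: S_pt; exact: total_obstacle.
- apply: inj_card_eq => m n _ _ /(congr1 co).
  by rewrite !co_pt; [exact: obstacle_inj|exact: total_obstacle..].
have /choice[h hP] : forall j, exists S', G S' /\ S' (pt (witness k j)).
  move=> j; have : S (pt (witness k j)) by apply: S_pt; exact: total_witness.
  by rewrite -GS => -[S' GS' S'j]; exists S'.
have h_lt i j : (i < j)%N -> (j < 2 * k + 1)%N -> h i <> h j.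
  move=> ij jk hij; have [Gi hi] := hP i; have [_ hj] := hP j.
  have := GT _ Gi; rewrite (homothets_corner bc) => -[g g1 hE].
  move: hi hj; rewrite -hij hE /corner /= !co_pt; try exact: total_witness.
  move=> gi gj; apply: (Gfree (pt (obstacle i./2)) _ _ Gi).
    (* The obstacle belongs to [P] because [i < j <= 2 * k] gives [i./2 < k]. *)
    by exists i./2 => //=; lia.
  rewrite hE (interior_corner _ _ bc) co_pt; last exact: total_obstacle.
  exact: witness_separated gi gj.
have h_inj : {in `I_(2 * k + 1) &, injective h}.
  move=> i j; rewrite !inE /= => ik jk hij.
  by case: (ltngtP i j) => // [ij|ji]; [case: (h_lt i j)|case: (h_lt j i)].
rewrite -card_le_II; apply: card_le_trans _ Gf.
rewrite -(card_le_eql (inj_card_eq h_inj)).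
by apply: subset_card_le => _ [j _ <-]; case: (hP j).
Qed.

Theorem theorem5 (R : realType) (T : set 'rV[R]_2)
  (hT : nondegenerate_triangle T) :
  [/\ self_coverable (homothets T),
      self_coverability_function (homothets T) (fun k => (2 * k + 1)%N)
    & forall g : nat -> nat, self_coverability_function (homothets T) g ->
        forall k : nat, (2 * k + 1 <= g k)%N].
Proof.
have [a [b [c [/barycentric_exists[co bc] ->]]]] := hT.
split.
- split; last by exists (fun k => (2 * k + 1)%N); exact: triangle_self_coverable bc.
  rewrite (homothets_corner bc) => _ [g _ ->]; exact: closed_corner bc.
- exact: triangle_self_coverable bc.
by move=> f fP k; exact: triangle_self_coverability_lower bc fP.
Qed.
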